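(* Let $G=(V,E)$ be a finite simple connected undirected graph on $n$ vertices with cut parameters $\alpha$, and consider the generalized random shortest path metric $d$ on $G$. For any fixed $\Delta\geq0$, the expected minimum number of clusters in a partition of $V$ into clusters each of diameter (with respect to $d$) at most $4\Delta$ is $O\left(1+n/\exp(\alpha\Delta n/5)\right)$.
   Context: Generalized random shortest path metric on $G$: each edge $e\in E$ independently receives a weight $w(e)\sim\mathrm{Exp}(1)$, and $d(u,v)$ is the minimum total weight of a $u$–$v$ path in $G$. Cut parameters: for $\varnothing\neq U\subsetneq V$ let $\delta(U)$ be the set of edges with exactly one endpoint in $U$ and $\mu_U=|U|(n-|U|)$; then $\alpha=\min_{U}|\delta(U)|/\mu_U$ and $\beta=\max_U|\delta(U)|/\mu_U$. The diameter of a cluster $C$ is $\max_{x,y\in C}d(x,y)$. The constant in the $O$-notation is absolute (independent of $G$, $n$ and $\Delta$). *)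

(* Defs.v *)
From HB Require Import structures.
From mathcomp Require Import all_boot all_order all_algebra.
From mathcomp Require Import all_classical all_reals all_analysis.
Set Implicit Arguments.
Unset Strict Implicit.
Unset Printing Implicit Defensive.
Import Order.TTheory GRing.Theory Num.Theory.
Import numFieldNormedType.Exports.
Local Open Scope classical_set_scope.
Local Open Scope ring_scope.

(* A finite simple graph is a symmetric irreflexive [e : rel T]; an edge is   *)
(* the two-element set of its endpoints.                                      *)
Section Graph.
Context (R : realType) (T : finType) (e : rel T).

Definition edges : {set {set T}} :=
  [set f : {set T} | [exists x, exists y, e x y && (f == [set x; y]%SET)]]%SET.

Definition cut (U : {set T}) : {set {set T}} :=
  [set f in edges | #|f :&: U| == 1%N]%SET.

Definition cut_ratio (U : {set T}) : R :=
  #|cut U|%:R / (#|U| * (#|T| - #|U|))%:R.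

Definition proper_nonempty (U : {set T}) : bool :=
  (U != finset.set0) && (U \proper [set: T]%SET).

(* The infimum of a finite set of reals, attained as soon as #|T| > 1         *)
(* (lemma [alpha_attained]); for #|T| <= 1 there is no cut and [alpha] is 0.  *)
Definition alpha : R := inf [set cut_ratio U | U in [set U | proper_nonempty U]].

(* In [path_weight w u p] and [simple_path u v p] the path visits the         *)
(* vertices [u :: p].                                                         *)
Definition path_weight (w : {set T} -> R) (u : T) (p : seq T) : R :=
  \sum_(q <- zip (u :: p) p) w [set q.1; q.2]%SET.

Definition simple_path (u v : T) (p : seq T) : bool :=
  [&& path e u p, last u p == v & uniq (u :: p)].

(* The infimum ranges over finitely many paths and is a minimum in a          *)
(* connected graph (lemma [dist_attained]).                                   *)
Definition dist (w : {set T} -> R) (u v : T) : R :=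
  inf [set path_weight w u p | p in [set p | simple_path u v p]].

(* The default value 0 is harmless, as [dist w x x = 0].                      *)
Definition diam (w : {set T} -> R) (C : {set T}) : R :=
  \big[Num.max/0]_(x in C) \big[Num.max/0]_(y in C) dist w x y.

Definition clustering (w : {set T} -> R) (r : R) (Q : {set {set T}}) : bool :=
  finset.partition Q [set: T]%SET && [forall C in Q, diam w C <= r].

(* For [0 <= r] the partition into singletons is a clustering (lemma          *)
(* [clustering_singletons]), so that the minimum makes sense.                 *)
Definition nclusters (w : {set T} -> R) (r : R) : nat :=
  #|[arg min_(Q < [set [set x] | x in T]%SET | clustering w r Q) #|Q|]|.

End Graph.

(* Mutual independence of the random variables [X i] with index in [A].       *)
Definition mutually_independent (d : measure_display) (Omega : measurableType d)
    (R : realType) (P : probability Omega R) (I : finType) (A : {set I})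
    (X : I -> {RV P >-> R}) : Prop :=
  forall (J : {set I}) (B : I -> set R), J \subset A ->
    (forall i, i \in J -> measurable (B i)) ->
    P (\bigcap_(i in [set i | i \in J]) (X i @^-1` B i)) =
    (\prod_(i in J) P (X i @^-1` B i))%E.

Definition has_exp1_law (d : measure_display) (Omega : measurableType d)
    (R : realType) (P : probability Omega R) (X : {RV P >-> R}) : Prop :=
  forall A : set R, measurable A -> distribution P X A = exponential_prob 1 A.

Section Sanity.
Context (R : realType) (T : finType) (e : rel T).

Lemma inf_attained (I : eqType) (F : I -> R) (s : seq I) (D : pred I) :
  {subset D <= s} -> (exists i, D i) ->
  exists2 i, D i & inf [set F i | i in [set i | D i]] = F i /\
                   (forall j, D j -> F i <= F j).
Proof.
move=> Ds [i0 Di0].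
have [i Di imin] : exists2 i, D i & forall j, D j -> F i <= F j.
  have {}Ds : forall j, D j -> j \in s by move=> j Dj; exact: Ds.
  have i0s := Ds _ Di0.
  have [i Di imin] : exists2 i, D i & forall j, D j -> j \in s -> F i <= F j.
    elim: s {Ds i0s} => [|a s [i Di imin]]; first by exists i0.
    have [Da|nDa] := boolP (D a); last first.
      exists i => // j Dj; rewrite inE => /orP[/eqP ja|]; last exact: imin.
      by move: nDa; rewrite -ja Dj.
    have [ai|ia] := leP (F a) (F i).
      exists a => // j Dj; rewrite inE => /orP[/eqP -> //|js].
      exact: le_trans ai (imin _ Dj js).
    exists i => // j Dj; rewrite inE => /orP[/eqP -> |js]; last exact: imin.
    exact: ltW.
  by exists i => // j Dj; apply: imin => //; exact: Ds.
exists i => //; split => //; apply/eqP; rewrite eq_le; apply/andP; split.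
  by apply: ge_inf; [exists (F i) => _ [j Dj <-]; exact: imin | exists i].
by apply: lb_le_inf; [exists (F i); exists i | move=> _ [j Dj <-]; exact: imin].
Qed.

Lemma alpha_attained : (1 < #|T|)%N ->
  exists2 U, proper_nonempty U & alpha R e = cut_ratio R e U /\
    (forall U', proper_nonempty U' -> cut_ratio R e U <= cut_ratio R e U').
Proof.
move=> T1; apply: (@inf_attained _ _ (enum {set T})) => [U _|].
  by rewrite mem_enum.
have /card_gt0P[x _] : (0 < #|T|)%N by exact: ltn_trans T1.
exists [set x]%SET; rewrite /proper_nonempty; apply/andP; split.
  by apply/finset.set0Pn; exists x; rewrite finset.in_set1.
by rewrite properEcard finset.subsetT cards1 cardsT.
Qed.

Lemma simple_path_bound u v p : simple_path e u v p ->
  p \in [seq val q | q : #|T|.-bseq T].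
Proof.
move=> /and3P[_ _ /= /andP[_ up]].
have sp : (size p <= #|T|)%N by rewrite -(card_uniqP up) max_card.
by apply/mapP; exists (Bseq sp); rewrite ?mem_enum.
Qed.

Lemma simple_path_exists u v : connect e u v -> exists p, simple_path e u v p.
Proof.
move=> /connectP[p pp ->]; case/shortenP: pp => p' pp' up' _.
by exists p'; rewrite /simple_path pp' eqxx.
Qed.

Lemma dist_attained (w : {set T} -> R) u v : connect e u v ->
  exists2 p, simple_path e u v p & dist e w u v = path_weight w u p /\
    (forall p', simple_path e u v p' -> path_weight w u p <= path_weight w u p').
Proof.
move=> /simple_path_exists uv.
apply: (@inf_attained _ _ [seq val q | q : #|T|.-bseq T]) => // p.
exact: simple_path_bound.
Qed.

Lemma dist_self (w : {set T} -> R) u : dist e w u u = 0.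
Proof.
have [p /and3P[_ /eqP lp up] [-> _]] := dist_attained w (connect0 e u).
case: p lp up => [|a p] /= lp; first by rewrite /path_weight big_nil.
by rewrite -[X in X \notin _]lp mem_last.
Qed.

Lemma clustering_singletons (w : {set T} -> R) r : 0 <= r ->
  clustering e w r [set [set x] | x in T]%SET.
Proof.
move=> r0; apply/andP; split; last first.
  apply/forallP => C; apply/implyP => /imsetP[x _ ->].
  rewrite /diam big_set1E big_set1E dist_self.
  by rewrite !maxxx.
rewrite /finset.partition; apply/and3P; split.
- apply/eqP/setP => x; rewrite !inE; apply/bigcupP.
  by exists [set x]%SET; rewrite ?set11// imset_f.
- apply/finset.trivIsetP => _ _ /imsetP[x _ ->] /imsetP[y _ ->] xy.
  rewrite disjoints1 finset.in_set1; apply: contra xy => /eqP ->.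
  by rewrite eqxx.
- apply/imsetP => -[x _ /setP/(_ x)].
  by rewrite !inE eqxx.
Qed.

End Sanity.

(* The number of clusters is a random variable, so its expectation is the     *)
(* genuine one (the library integral is defined for all functions).           *)
Section Measurability.
Context (R : realType) (T : finType) (e : rel T).
Context (d : measure_display) (Omega : measurableType d).
Context (w : {set T} -> Omega -> R).
Hypothesis mw : forall f, measurable_fun setT (w f).

Let wt (omega : Omega) : {set T} -> R := fun f => w f omega.

Lemma measurable_dist_le u v c : connect e u v ->
  measurable [set omega | dist e (wt omega) u v <= c].
Proof.
move=> uv.
rewrite (_ : mkset _ = \bigcup_(p in [set p : #|T|.-bseq T | simple_path e u v p])
   [set omega | path_weight (wt omega) u p <= c]).
  apply: fin_bigcup_measurable => [|p _]; first exact: finite_finset.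
  rewrite -[X in measurable X]setTI; apply: measurable_fun_le => //.
  rewrite /path_weight; apply: measurable_sum => q; exact: mw.
apply/seteqP; split => omega /=.
  have [p sp [-> _]] := dist_attained (wt omega) uv.
  have /mapP[q _ pq] := simple_path_bound sp.
  by rewrite pq in sp * => le_c; exists q.
move=> [p /= sp]; apply: le_trans.
by have [q sq [-> ]] := dist_attained (wt omega) uv; apply.
Qed.

Lemma measurable_nclusters r : (forall x y, connect e x y) ->
  measurable_fun setT (fun omega => (nclusters e (wt omega) r)%:R : R).
Proof.
move=> ec.
pose D omega := [ffun xy : T * T => dist e (wt omega) xy.1 xy.2 <= r].
have mD b : measurable (D @^-1` [set b]).
  rewrite (_ : _ @^-1` _ = \bigcap_(xy in [set: T * T])
      [set omega | (dist e (wt omega) xy.1 xy.2 <= r) = b xy]).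
    apply: fin_bigcap_measurable => [|xy _]; first exact: finite_finset.
    have := @measurable_dist_le xy.1 xy.2 r (ec _ _).
    case: (b xy) => // /measurableC; congr (measurable _).
    by apply/seteqP; split => omega /=; [move/negP/negbTE|move=> ->].
  apply/seteqP; split => omega /=; first by move=> <- xy _; rewrite /= ffunE.
  by move=> h; apply/ffunP => xy; rewrite ffunE; exact: h.
pose cl (b : {ffun T * T -> bool}) (Q : {set {set T}}) : bool :=
  finset.partition Q [set: T]%SET &&
  [forall C in Q, (0 <= r) && [forall x in C, forall y in C, b (x, y)]].
pose g b : R := #|[arg min_(Q < [set [set x] | x in T]%SET | cl b Q) #|Q|]|%:R.
rewrite (_ : (fun _ => _) = g \o D); last first.
  apply/funext => omega; rewrite /g /nclusters /=; congr (#|_|%:R).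
  rewrite (_ : clustering e (wt omega) r = cl (D omega)) //.
  apply/funext => Q; rewrite /clustering /cl; congr (_ && _).
  apply: eq_forallb => C; congr (_ ==> _).
  rewrite /diam; apply/idP/andP => [/bigmax_leP[r0 h]|[r0 h]].
    split => //; apply/forall_inP => x xC; apply/forall_inP => y yC.
    by rewrite ffunE; have /bigmax_leP[_] := h _ xC; apply.
  apply/bigmax_leP; split => // x xC; apply/bigmax_leP; split => // y yC.
  by move: h => /forall_inP/(_ _ xC)/forall_inP/(_ _ yC); rewrite ffunE.
move=> _ A _; rewrite setTI.
rewrite (_ : _ @^-1` _ = \bigcup_(b in [set b | A (g b)]) (D @^-1` [set b])).
  by apply: fin_bigcup_measurable => [|b _]; [exact: finite_finset|exact: mD].
apply/seteqP; split => omega; first by exists (D omega).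
by move=> [b Agb Db]; rewrite /preimage /= Db.
Qed.

End Measurability.

(* Main.v *)
(* Explore the graph from v in L time steps of length eps = Delta / L. By     *)
(* memorylessness, in each step every edge leaving the explored set U is      *)
(* crossed with probability 1 - exp(-eps), independently of the past. As      *)
(* |cut U| >= alpha |U| (n - |U|), the mean of 1/|U| therefore shrinks by     *)
(* a factor exp(-2/5 alpha n eps) per step while |U| <= n/10. Markov's        *)
(* inequality then shows that, with s = min(exp(alpha n Delta / 5),           *)
(* (n + 1)/10), the ball of radius Delta around v has fewer than s vertices   *)
(* with probability at most exp(- alpha n Delta / 5). Finally take a maximal  *)
(* family of disjoint balls of radius Delta with at least s vertices: there   *)
(* are at most n/s of them, every other centre of such a ball is within       *)
(* 2 Delta of theirs, and the remaining vertices become singletons.           *)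

Require Import Defs.
From HB Require Import structures.
From mathcomp Require Import all_boot all_order all_algebra.
From mathcomp Require Import all_classical all_reals all_analysis.
From mathcomp Require Import measurable_realfun ring lra.
Import Defs.
Set Implicit Arguments.
Unset Strict Implicit.
Unset Printing Implicit Defensive.
Import Order.TTheory GRing.Theory Num.Theory.
Import numFieldNormedType.Exports.
Local Open Scope classical_set_scope.
Local Open Scope ring_scope.

(** Write x = alpha n Delta. Two facts combine.

    Deterministic ([nclusters_le]): a maximal packing of disjoint Delta-balls with at least s
    vertices yields a clustering of diameter 4 Delta with at most n/s clusters plus one for each
    vertex whose ball is smaller than s.

    Probabilistic ([prob_slow_ball]): small balls are rare. The explored set U only grows, at a rate
    governed by |cut U|, so s/|U|, rescaled by a constant factor per step, is a supermartingale. No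
    conditional expectation is formed: [prob_slow] is an induction on the number of steps over
    explicit states (explored set, age of each edge, range still possible for each weight).
    Independence turns the probability of the ranges into a product over edges, and memorylessness
    evaluates its factors. Discretisation is harmless: a vertex counts as reached only at the end of
    a step, so the explored set lies inside the true ball ([reach_dual]), and a fine step costs only
    a constant in the drift ([exploration_drift]).

    With s at most exp(x/5), a given ball is small with probability at most exp(-2x/5) s <=
    exp(-x/5), and summing over the vertices gives the bound. *)

Lemma le_measure_fin_cover (d : measure_display) (Omega : measurableType d)
    (R : realType) (mu : {measure set Omega -> \bar R}) (I : finType)
    (Q : pred I) (E : I -> set Omega) (X : set Omega) :
  (forall i, measurable (E i)) -> measurable X ->
  (forall omega, X omega -> exists2 i, Q i & E i omega) ->
  (mu X <= \sum_(i | Q i) mu (E i))%E.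
Proof.
move=> mE mX XE.
have [mB leB] : measurable (\big[setU/set0]_(i | Q i) E i) /\
    (mu (\big[setU/set0]_(i | Q i) E i) <= \sum_(i | Q i) mu (E i))%E.
  elim/big_ind2 : _ => [|A a B b [mA leA] [mB leB]|i _] //.
    by split; [exact: measurable0|rewrite measure0].
  split; first exact: measurableU.
  exact: le_trans (measureU2 _ mA mB) (leeD leA leB).
apply: le_trans leB; apply: le_measure; rewrite ?inE// => omega /XE[i Qi Ei].
by rewrite (bigD1 i)//=; left.
Qed.

Lemma exponential_prob_tail (R : realType) (t : R) : 0 <= t ->
  exponential_prob 1 `]t, +oo[ = (expR (- t))%:E.
Proof.
move=> t0; have c1 : continuous (fun z : R^o => expR (- 1 * z)).
  move=> z; apply: continuous_comp; last exact: continuous_expR.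
  by apply: continuousM => //; exact: cst_continuous.
rewrite /exponential_prob integral_itv_obnd_cbnd; last first.
  apply/measurable_EFinP; apply: measurable_funTS.
  exact: measurable_exponential_pdf.
rewrite (@ge0_continuous_FTC2y _ _ (fun x => - expR (- 1 * x)) _ 0)//.
- by rewrite EFinN oppeK add0e mulN1r.
- by move=> x _; exact: exponential_pdf_ge0.
- apply: (@continuous_subspaceW R^o _ _ [set` `[0, +oo[%R]).
    by move=> x /=; rewrite !in_itv/= !andbT; exact: le_trans.
  exact: within_continuous_exponential_pdf.
- rewrite -oppr0; apply: cvgN.
  rewrite (_ : (fun x => expR (- 1 * x)) = (fun z => expR (- z))).
    exact: cvgr_expR.
  by apply: eq_fun => x; rewrite mulN1r.
- by apply: cvgN; apply/cvg_at_right_filter; exact: c1.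
- move=> x; rewrite in_itv/= andbT => tx; apply: derive1_exponential_pdf.
  by rewrite in_itv/= andbT (le_lt_trans t0).
Qed.

(** * The discretised exploration and its comparison with the metric *)

Section Exploration.
Context (R : realType) (T : finType) (e : rel T) (eps : R).
Context (e_sym : symmetric e) (e_irr : irreflexive e) (eps0 : 0 <= eps).
Implicit Types (U : {set T}) (F : {set {set T}}) (a w : {set T} -> R).

(** An edge is the set of its two endpoints, so adjoining the crossed edges adds exactly their far
    endpoints. *)
Definition spread U F : {set T} := (U :|: finset.cover (F :&: cut e U))%SET.

(** Edges that fire are aged too; this is harmless, since they then lie inside the explored set and
    never return to a cut. *)
Definition age U a : {set T} -> R :=
  fun f => if f \in cut e U then a f + eps else a f.

Definition fired U a w : {set {set T}} :=
  [set f in cut e U | w f <= a f + eps]%SET.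

Lemma mem_fired U a w f :
  (f \in fired U a w) = (f \in cut e U) && (w f <= a f + eps).
Proof. by rewrite inE. Qed.

(* The explored set after [L] steps from [U], where [a f] is the time for     *)
(* which the exploration has already been travelling along the edge [f].      *)
Fixpoint reach (L : nat) U a w : {set T} :=
  if L is L'.+1 then reach L' (spread U (fired U a w)) (age U a) w else U.

Lemma edge_mem x y : e x y -> [set x; y]%SET \in edges e.
Proof.
by move=> xy; rewrite inE; apply/existsP; exists x; apply/existsP; exists y; rewrite xy eqxx.
Qed.

Lemma cut_edge U x y : e x y ->
  ([set x; y]%SET \in cut e U) = (x \in U) (+) (y \in U).
Proof.
move=> xy; have nxy : x != y by apply: contraTneq xy => ->; rewrite e_irr.
rewrite inE edge_mem//= finset.setIUl cardsU.
rewrite (_ : ([set x] :&: U :&: ([set y] :&: U) = finset.set0)%SET) ?cards0 ?subn0; last first.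
  apply/setP => z; rewrite !inE; have [->|//] := eqVneq z x.
  by rewrite (negbTE nxy) andbF.
have c1 z : #|([set z] :&: U)%SET| = (z \in U).
  have [zU|zU] := boolP (z \in U).
    by rewrite (finset.setIidPl _) ?cards1// finset.sub1set.
  by apply/eqP; rewrite cards_eq0 setI_eq0 disjoints1.
by rewrite !c1; case: (x \in U); case: (y \in U).
Qed.

Lemma cutP U f : f \in cut e U ->
  exists x y, [/\ x \in U, y \notin U, e x y & f = [set x; y]%SET].
Proof.
move=> fc; have := fc; rewrite inE => /andP[]; rewrite inE.
move=> /existsP[x /existsP[y /andP[xy /eqP fE]]] _.
move: fc; rewrite fE cut_edge//.
have [xU|xU] /= := boolP (x \in U); first by exists x, y.
by move=> yU; exists y, x; rewrite e_sym finset.setUC.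
Qed.

Lemma sub_spread U F : U \subset spread U F.
Proof. exact: finset.subsetUl. Qed.

Lemma sub_reach L U a w : U \subset reach L U a w.
Proof.
by elim: L U a => [|L IH] U a //=; exact: fintype.subset_trans (sub_spread _ _) (IH _ _).
Qed.

Lemma card_spread U F f : f \in F -> f \in cut e U ->
  (#|U| < #|spread U F|)%N.
Proof.
move=> fF fc; have [x [y [xU yU _ fE]]] := cutP fc.
apply: proper_card; apply/properP; split; first exact: sub_spread.
exists y => //; rewrite inE; apply/orP; right.
by apply/bigcupP; exists f; [rewrite finset.in_setI fF|rewrite fE !inE eqxx orbT].
Qed.

(* The constraints on [D] are those of the linear program dual to the         *)
(* shortest path problem, seen from the current state of the exploration.     *)
Lemma reach_dual L U a w (D : T -> R) (t : R) :
  (forall x, x \in U -> D x <= t) ->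
  (forall x y, e x y -> x \in U -> y \notin U ->
     D y <= t + (w [set x; y]%SET - a [set x; y]%SET)) ->
  (forall x y, e x y -> D y <= D x + w [set x; y]%SET) ->
  (forall x y, e x y -> x \notin U -> y \notin U -> a [set x; y]%SET = 0) ->
  forall x, x \in reach L U a w -> D x <= t + L%:R * eps.
Proof.
elim: L U a t => [|L IH] U a t DU Dcut Dedge a0 x.
  by rewrite mul0r addr0; exact: DU.
rewrite -nat1r mulrDl mul1r addrA /=; apply: IH => //.
- have DU' y : y \in U -> D y <= t + eps.
    by move=> /DU Dt; rewrite (le_trans Dt)// lerDl.
  move=> y; rewrite inE => /orP[/DU'//|].
  move=> /bigcupP[f]; rewrite finset.in_setI => /andP[]; rewrite inE => /andP[fc wf] _.
  have [u [v [uU vU uv fE]]] := cutP fc.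
  rewrite fE !inE => /orP[]/eqP -> //; first exact: DU'.
  apply: le_trans (Dcut _ _ uv uU vU) _.
  by rewrite lerD2l lerBlDl -fE.
(* If [u] was explored before, the residual time along the edge drops by [eps] just as the clock
   advances. If [u] is new, then [D u <= t + eps] because the edge that reached it fired, and the
   edge to [v] is still fresh. *)
- move=> u v uv uS vS; rewrite /age cut_edge//.
  have vU : v \notin U by apply: contra vS; apply/fintype.subsetP/sub_spread.
  have [uU|uU] /= := boolP (u \in U); rewrite (negbTE vU) /=.
    have := Dcut _ _ uv uU vU; lra.
  rewrite a0//.
  move: uS; rewrite inE (negbTE uU)/= => /bigcupP[f].
  rewrite finset.in_setI => /andP[]; rewrite inE => /andP[fc wf] _.
  have [u' [v' [uU' vU' uv' fE]]] := cutP fc.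
  rewrite fE !inE => /orP[]/eqP uE; first by rewrite uE uU' in uU.
  have := Dcut _ _ uv' uU' vU'; have := Dedge _ _ uv; rewrite -fE uE; lra.
- move=> u v uv; rewrite !inE !negb_or => /andP[uU _] /andP[vU _].
  by rewrite /age cut_edge// (negbTE uU) (negbTE vU) a0.
Qed.

Context (d : measure_display) (Omega : measurableType d).
Context (P : probability Omega R).
Context (W : {set T} -> {RV P >-> R}).
Context (W_exp : forall f, f \in edges e -> has_exp1_law (W f)).
Context (W_ind : mutually_independent (edges e) W).
Implicit Types A : {set T} -> set R.

Let wt (omega : Omega) : {set T} -> R := fun f => W f omega.

Lemma measurable_weight_mem f (B : set R) :
  measurable B -> measurable [set omega | B (W f omega)].
Proof. by move=> mB; rewrite -[X in measurable X]setTI; exact: measurable_funPT. Qed.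

Lemma measurable_reach (p : pred {set T}) L U a :
  measurable [set omega | p (reach L U a (wt omega))].
Proof.
elim: L U a => [|L IH] U a.
  have [pU|pU] := boolP (p U).
    by rewrite (_ : mkset _ = setT) //; apply/seteqP; split.
  by rewrite (_ : mkset _ = set0) //; apply/seteqP; split => omega //=; rewrite (negbTE pU).
(* Split by the set [F] of edges firing in the first step; once [F] is fixed, the next state no
   longer depends on [omega]. *)
rewrite (_ : mkset _ = \bigcup_(F in [set: {set {set T}}])
   ((\bigcap_(f in [set: {set T}])
      [set omega | (f \in fired U a (wt omega)) = (f \in F)]) `&`
    [set omega | p (reach L (spread U F) (age U a) (wt omega))])).
  apply: fin_bigcup_measurable => [|F _]; first exact: finite_finset.
  apply: measurableI => //.
  apply: fin_bigcap_measurable => [|f _]; first exact: finite_finset.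
  have mf : measurable [set omega | W f omega <= a f + eps].
    have := @measurable_weight_mem f `]-oo, a f + eps] (measurable_itv _).
    by congr measurable; apply/seteqP; split => omega /=; rewrite in_itv.
  pose B := [set omega | (f \in cut e U) && (W f omega <= a f + eps)].
  rewrite (_ : mkset _ = if f \in F then B else ~` B); last first.
    apply/seteqP; split => omega /=; rewrite ?mem_fired;
      case: (f \in F) => //.
    - by move=> /negbT/negP.
    - by move=> /negP/negbTE.
  have mB : measurable B.
    rewrite /B; case: (f \in cut e U) => //=.
    by rewrite (_ : mkset _ = set0)//; apply/seteqP; split => omega.
  by case: (f \in F) => //; exact: measurableC.
apply/seteqP; split => omega /=.
  by move=> h; exists (fired U a (wt omega)).
move=> [F _ [hF]]; rewrite (_ : F = fired U a (wt omega))//.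
by apply/setP => f; rewrite hF.
Qed.

(** * Probability that the exploration is slow *)

(** Carrying the ranges [A f] inside the event replaces conditioning on the past: [prob_slow]
    compares this probability with that of the ranges alone. *)
Definition slow (s : R) L U a A : set Omega :=
  [set omega | #|reach L U a (wt omega)|%:R < s] `&`
  \bigcap_(f in [set f | f \in edges e]) (W f @^-1` A f).

Lemma measurable_slow s L U a A : (forall f, measurable (A f)) ->
  measurable (slow s L U a A).
Proof.
move=> mA; apply: measurableI.
  exact: (@measurable_reach (fun V => #|V|%:R < s)).
apply: fin_bigcap_measurable => [|f _]; first exact: finite_finset.
exact: measurable_weight_mem.
Qed.

Lemma slow0 s L U a A : s <= #|U|%:R -> slow s L U a A = set0.
Proof.
move=> sU; apply/seteqP; split => omega //= -[/= + _].
by apply/negP; rewrite -leNgt (le_trans sU)// ler_nat subset_leq_card// sub_reach.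
Qed.

Definition prW f (B : set R) : R := fine (P (W f @^-1` B)).

Lemma prWE f B : measurable B -> P (W f @^-1` B) = (prW f B)%:E.
Proof.
move=> mB; rewrite fineK//; apply: fin_num_measure; exact: measurable_weight_mem.
Qed.

Lemma prW_ge0 f B : 0 <= prW f B.
Proof. by rewrite fine_ge0. Qed.

Lemma prW_tail f t : f \in edges e -> 0 <= t -> prW f `]t, +oo[ = expR (- t).
Proof.
move=> fe t0; have := W_exp fe (measurable_itv `]t, +oo[).
by rewrite exponential_prob_tail// /prW => PE; rewrite [P _]PE.
Qed.

Lemma prW_split f (B : set R) c : measurable B ->
  prW f B = prW f (B `&` `]-oo, c]) + prW f (B `&` `]c, +oo[).
Proof.
move=> mB; apply: EFin_inj; rewrite EFinD -!prWE//; try exact: measurableI.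
rewrite -measureU//; try exact: measurable_weight_mem (measurableI _ _ _ _).
  congr (P _); apply/seteqP; split => omega /=; rewrite !in_itv/= andbT.
    by case: (leP (W f omega) c); [left|right].
  by move=> [[]|[]].
apply/seteqP; split => omega //=; rewrite !in_itv/= andbT => -[[_ h1] [_]].
by rewrite ltNge h1.
Qed.

(* [A f] is the range still possible for the weight of [f]; it is updated     *)
(* once [F] is known to be the set of edges of [cut U] that fire.             *)
Definition cond_fired U F a A : {set T} -> set R := fun f =>
  if f \in cut e U then
    A f `&` (if f \in F then `]-oo, a f + eps]%classic
             else `]a f + eps, +oo[%classic)
  else A f.

Lemma measurable_cond_fired U F a A : (forall f, measurable (A f)) ->
  forall f, measurable (cond_fired U F a A f).
Proof.
move=> mA f; rewrite /cond_fired; case: ifP => // _; apply: measurableI => //.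
by case: ifP.
Qed.

Lemma cut_sub_edges U : cut e U \subset edges e.
Proof. by apply/fintype.subsetP => f; rewrite inE => /andP[]. Qed.

Lemma sum_cond_fired U a A : (forall f, measurable (A f)) ->
  \sum_(F : {set {set T}} | F \subset cut e U)
     \prod_(f in edges e) prW f (cond_fired U F a A f) =
  \prod_(f in edges e) prW f (A f).
Proof.
move=> mA.
pose X f := if f \in cut e U then prW f (A f `&` `]-oo, a f + eps]) else 0.
pose Y f := if f \in cut e U then prW f (A f `&` `]a f + eps, +oo[)
  else if f \in edges e then prW f (A f) else 1.
transitivity (\prod_f (X f + Y f)); last first.
  rewrite [RHS]big_mkcond; apply: eq_bigr => f _; rewrite /X /Y.
  have [fc|fc] := boolP (f \in cut e U); last by rewrite add0r.
  by rewrite (fintype.subsetP (cut_sub_edges U))// -prW_split.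
(* Expanding the product of sums gives one term per set of fired edges; a set not contained in the
   cut contributes 0, as [X] vanishes off the cut. *)
rewrite bigA_distr [RHS](bigID (fun F : {set {set T}} => F \subset cut e U))/=.
rewrite [X in _ = _ + X]big1 ?addr0; last first.
  move=> F /fintype.subsetPn[f fF fc].
  by rewrite (bigD1 f)//= fF /X (negbTE fc) mul0r.
apply: eq_bigr => F Fc; rewrite big_mkcond; apply: eq_bigr => f _.
rewrite /cond_fired /X /Y; have [fc|fc] := boolP (f \in cut e U).
  by rewrite (fintype.subsetP (cut_sub_edges U))//; case: ifP.
have -> : (f \in F) = false by apply: contraNF fc; exact: (fintype.subsetP Fc).
by [].
Qed.


(** Memorylessness: a cut edge is not contained in [U], so its range is a half-line, and moving the
    endpoint from [a f] to [a f + eps] costs a factor [expR (- eps)]. *)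
Lemma prod_cond_fired0 U a A :
  (forall f, f \in edges e -> ~~ (f \subset U) ->
     0 <= a f /\ A f = `]a f, +oo[%classic) ->
  \prod_(f in edges e) prW f (cond_fired U finset.set0 a A f) =
  expR (- eps) ^+ #|cut e U| * \prod_(f in edges e) prW f (A f).
Proof.
move=> hA; rewrite -prodr_const big_mkcond [X in _ * X]big_mkcond.
rewrite [X in X * _]big_mkcond -big_split/=; apply: eq_bigr => f _.
rewrite /cond_fired; have [fc|fc] := boolP (f \in cut e U); last by rewrite mul1r.
have fe := fintype.subsetP (cut_sub_edges U) _ fc.
have fU : ~~ (f \subset U).
  have [x [y [_ yU _ ->]]] := cutP fc.
  by apply/fintype.subsetPn; exists y => //; rewrite !inE eqxx orbT.
have [a0 ->] := hA _ fe fU.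
rewrite fe inE (_ : _ `&` _ = `]a f + eps, +oo[%classic).
  by rewrite !prW_tail ?addr_ge0// opprD expRD mulrC.
apply/seteqP; split => x /=; rewrite !in_itv/= !andbT; first by case.
by move=> h; split => //; apply: le_lt_trans h; rewrite lerDl.
Qed.

(** The invariant of the induction in [prob_slow]: a cut edge that did not fire still has a
    half-line starting at its age, while one that fired is swallowed by the explored set. *)
Lemma cond_fired_outside U F a A (f : {set T}) : F \subset cut e U ->
  (~~ (f \subset U) -> 0 <= a f /\ A f = `]a f, +oo[%classic) ->
  ~~ (f \subset spread U F) ->
  0 <= age U a f /\ cond_fired U F a A f = `]age U a f, +oo[%classic.
Proof.
move=> Fc hA fS.
have fU : ~~ (f \subset U).
  by apply: contra fS => /fintype.subset_trans; apply; exact: sub_spread.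
have [a0 AE] := hA fU; rewrite /age /cond_fired AE.
have [fc|//] := boolP (f \in cut e U).
split; first by rewrite addr_ge0.
have -> : (f \in F) = false.
  apply/negP => fF; move/negP : fS; apply.
  apply: fintype.subset_trans (finset.subsetUr _ _).
  by apply: (finset.bigcup_sup f); rewrite finset.in_setI fF.
apply/seteqP; split => x /=; rewrite !in_itv/= !andbT; first by case.
by move=> h; split => //; apply: le_lt_trans h; rewrite lerDl.
Qed.

Lemma slow_step s L U a A omega : slow s L.+1 U a A omega ->
  exists2 F : {set {set T}}, F \subset cut e U &
    slow s L (spread U F) (age U a) (cond_fired U F a A) omega.
Proof.
move=> [/= sS AW]; exists (fired U a (wt omega)).
  by apply/fintype.subsetP => f; rewrite mem_fired => /andP[].
split => //= f fe; rewrite /preimage/= /cond_fired mem_fired.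
have := AW f fe; case: ifPn => //= fc Af; split => //.
by rewrite fc; case: leP => h; rewrite /= in_itv/= ?andbT.
Qed.

(* A single step multiplies the weight [s / #|U|] of a state by at most [rho] *)
(* on average; as [s / #|U|] exceeds 1 on the states with fewer than [s]      *)
(* vertices, this bounds the probability of such a state.                     *)
Lemma prob_slow (s rho : R) : 0 <= s -> 0 <= rho ->
  (forall U, U != finset.set0 -> #|U|%:R < s ->
     expR (- eps) ^+ #|cut e U| / #|U|%:R +
     (1 - expR (- eps) ^+ #|cut e U|) / #|U|.+1%:R <= rho / #|U|%:R) ->
  forall L U a A, U != finset.set0 -> (forall f, measurable (A f)) ->
  (forall f, f \in edges e -> ~~ (f \subset U) ->
     0 <= a f /\ A f = `]a f, +oo[%classic) ->
  (P (slow s L U a A) <=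
   (rho ^+ L * (s / #|U|%:R) * \prod_(f in edges e) prW f (A f))%:E)%E.
Proof.
move=> s0 rho0 hstep; elim=> [|L IH] U a A U0 mA hA;
  have prod_ge0 B : 0 <= \prod_(f in edges e) prW f (B f)
    by apply: prodr_ge0 => *; exact: prW_ge0.
  have [sU|Us] := leP s #|U|%:R.
    by rewrite slow0// measure0 lee_fin !mulr_ge0.
  (* With no step left, drop the size condition: by independence the ranges have the product as
     probability, and the factor [s / #|U|] exceeds 1. *)
  apply: (@le_trans _ _ (\prod_(f in edges e) prW f (A f))%:E).
    rewrite -prodEFin; under eq_bigr do rewrite -prWE//.
    rewrite -W_ind//; apply: le_measure; rewrite ?inE.
    - exact: measurable_slow.
    - apply: fin_bigcap_measurable => [|f _]; first exact: finite_finset.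
      exact: measurable_weight_mem.
    - exact: subIsetr.
  rewrite lee_fin expr0 mul1r ler_peMl// ler_pdivlMr ?mul1r ?ltW//.
  by rewrite ltr0n card_gt0.
have [sU|Us] := leP s #|U|%:R.
  by rewrite slow0// measure0 lee_fin !mulr_ge0// exprn_ge0.
have U_gt0 : 0 < #|U|%:R :> R by rewrite ltr0n card_gt0.
apply: (@le_trans _ _ (\sum_(F : {set {set T}} | F \subset cut e U)
    (rho ^+ L * (s / #|spread U F|%:R) *
      \prod_(f in edges e) prW f (cond_fired U F a A f))%:E)%E).
  apply: (@le_trans _ _ (\sum_(F : {set {set T}} | F \subset cut e U)
      P (slow s L (spread U F) (age U a) (cond_fired U F a A)))%E).
    apply: le_measure_fin_cover; last exact: slow_step.
      by move=> F; apply: measurable_slow => f; exact: measurable_cond_fired.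
    exact: measurable_slow.
  apply: lee_sum => F Fc; apply: IH.
  - apply: contra U0 => /eqP S0; rewrite -finset.subset0 -S0; exact: sub_spread.
  - by move=> f; exact: measurable_cond_fired.
  - by move=> f fe; apply: cond_fired_outside => //; exact: hA.
rewrite sumEFin lee_fin; set Pi := \prod_(f in edges e) prW f (A f).
pose c F := \prod_(f in edges e) prW f (cond_fired U F a A f).
have sumc : \sum_(F : {set {set T}} | F \subset cut e U) c F = Pi by exact: sum_cond_fired.
have c0 : c finset.set0 = expR (- eps) ^+ #|cut e U| * Pi by exact: prod_cond_fired0.
set q := expR (- eps) ^+ #|cut e U| in hstep c0 *.
move: sumc; rewrite (bigD1 finset.set0) ?finset.sub0set//= -/(c _) c0 => sumc.
rewrite (bigD1 finset.set0) ?finset.sub0set//= -/(c _) c0.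
(* If nothing fires, the size is at least [#|U|]; any nonempty [F] adds at least one vertex.
   Crediting just one is enough for the drift. *)
apply: (@le_trans _ _ (rho ^+ L * (s / #|U|%:R) * (q * Pi) +
   \sum_(F : {set {set T}} | (F \subset cut e U) && (F != finset.set0))
     rho ^+ L * (s / #|U|.+1%:R) * c F)).
  apply: lerD.
    apply: ler_wpM2r; first by rewrite -c0; exact: prod_ge0.
    apply: ler_wpM2l; first exact: exprn_ge0.
    apply: ler_wpM2l => //; rewrite lef_pV2 ?posrE//.
      by rewrite ler_nat subset_leq_card// sub_spread.
    by rewrite (lt_le_trans U_gt0)// ler_nat subset_leq_card// sub_spread.
  apply: ler_sum => F /andP[Fc /finset.set0Pn[f fF]].
  apply: ler_wpM2r; first exact: prod_ge0.
  apply: ler_wpM2l; first exact: exprn_ge0.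
  have fc := fintype.subsetP Fc _ fF.
  have := card_spread fF fc => lt_card.
  apply: ler_wpM2l => //; rewrite lef_pV2 ?posrE ?ltr0n ?ler_nat//.
  exact: leq_ltn_trans lt_card.
rewrite -mulr_sumr (_ : \sum_(_ | _) _ = Pi - q * Pi); last first.
  by apply: (addrI (q * Pi)); rewrite sumc addrC subrK.
have := hstep _ U0 Us; rewrite -/q => h.
rewrite exprSr.
have -> : rho ^+ L * (s / #|U|%:R) * (q * Pi) + rho ^+ L * (s / #|U|.+1%:R) *
    (Pi - q * Pi) = rho ^+ L * s * Pi * (q / #|U|%:R + (1 - q) / #|U|.+1%:R) by ring.
have -> : rho ^+ L * rho * (s / #|U|%:R) * Pi = rho ^+ L * s * Pi * (rho / #|U|%:R) by ring.
by apply: ler_wpM2l h; rewrite !mulr_ge0// ?exprn_ge0//; exact: prod_ge0.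
Qed.

End Exploration.

(** * The shortest path metric and the packing argument *)

Section Distance.
Context (R : realType) (T : finType) (e : rel T) (w : {set T} -> R).
Context (e_sym : symmetric e) (e_conn : forall x y : T, connect e x y).
Context (w_ge0 : forall x y, e x y -> 0 <= w [set x; y]%SET).

Lemma path_weight_cons (u x : T) (p : seq T) :
  path_weight w u (x :: p) = w [set u; x]%SET + path_weight w x p.
Proof. by rewrite /path_weight /= big_cons. Qed.

Lemma path_weight_ge0 u p : path e u p -> 0 <= path_weight w u p.
Proof.
elim: p u => [|x p IH] u /=; first by rewrite /path_weight big_nil.
by move=> /andP[ux px]; rewrite path_weight_cons addr_ge0 ?w_ge0// IH.
Qed.

Lemma path_weight_cat u p q :
  path_weight w u (p ++ q) = path_weight w u p + path_weight w (last u p) q.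
Proof.
elim: p u => [|x p IH] u /=; first by rewrite /path_weight big_nil add0r.
by rewrite !path_weight_cons IH addrA.
Qed.

(** Loop erasure. It is needed because [dist] ranges over simple paths, while concatenating paths
    for the triangle inequality may create repetitions. *)
Lemma simple_path_shorter u p : path e u p ->
  exists2 q, simple_path e u (last u p) q & path_weight w u q <= path_weight w u p.
Proof.
elim: p u => [|x p IH] u /=; first by exists [::]; rewrite // /simple_path /= eqxx.
move=> /andP[ux /IH[q /and3P[pq /eqP lq uq] wq]].
have [uxq|uxq] := boolP (u \in x :: q); last first.
  exists (x :: q); first by rewrite /simple_path /= ux pq lq eqxx uxq.
  by rewrite !path_weight_cons lerD2l.
case/splitPl: uxq pq lq uq wq => q1 q2 lu.
rewrite cat_path path_weight_cat last_cat lu => /andP[pq1 pq2] lq uq wq.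
exists q2.
  rewrite /simple_path pq2 lq eqxx /=.
  move: uq; rewrite -cat_cons cat_uniq lastI -cats1 => /and3P[_ + uq2].
  rewrite uq2 andbT -all_predC => /allP nq; apply/negP => uq2'.
  by have := nq _ uq2'; rewrite /= mem_cat mem_seq1 lu eqxx orbT.
rewrite path_weight_cons; have := path_weight_ge0 pq1; have := w_ge0 ux.
lra.
Qed.

Lemma dist_le_path u p :
  path e u p -> dist e w u (last u p) <= path_weight w u p.
Proof.
move=> /simple_path_shorter[q sq]; apply: le_trans.
by have [q' _ [-> ]] := dist_attained w (e_conn u (last u p)); apply.
Qed.

Lemma dist_path u v :
  exists p, [/\ path e u p, last u p = v & dist e w u v = path_weight w u p].
Proof.
have [p /and3P[pp /eqP lp _] [-> _]] := dist_attained w (e_conn u v).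
by exists p.
Qed.

Lemma dist_triangle x y z : dist e w x z <= dist e w x y + dist e w y z.
Proof.
have [p [pp lp ->]] := dist_path x y; have [q [pq lq ->]] := dist_path y z.
rewrite -lp -path_weight_cat.
have := @dist_le_path x (p ++ q); rewrite last_cat lp lq; apply.
by rewrite cat_path pp lp.
Qed.

Lemma dist_edge x y : e x y -> dist e w x y <= w [set x; y]%SET.
Proof.
move=> xy; have := @dist_le_path x [:: y]; rewrite /= xy path_weight_cons.
by rewrite /path_weight big_nil addr0; apply.
Qed.

Lemma dist_sym_le x y : dist e w y x <= dist e w x y.
Proof.
have [p [pp <- ->]] := dist_path x y.
elim: p x pp => [|z p IH] x /=; first by rewrite dist_self /path_weight big_nil.
move=> /andP[xz pz]; rewrite path_weight_cons addrC.
apply: le_trans (dist_triangle _ z _) _; apply: lerD; first exact: IH.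
by rewrite finset.setUC dist_edge// e_sym.
Qed.

Lemma dist_sym x y : dist e w x y = dist e w y x.
Proof. by apply/eqP; rewrite eq_le !dist_sym_le. Qed.

Definition cball (r : R) (v : T) : {set T} := [set x | dist e w v x <= r]%SET.

(** By maximality, a vertex with a large ball has its ball meet one of the packing, hence lies
    within [2 * r] of that centre; two vertices with a common centre are then within [4 * r]. *)
Lemma nclusters_le (r s : R) : 0 <= r -> 0 < s ->
  (nclusters e w (4 * r))%:R <=
  #|T|%:R / s + #|[set v | #|cball r v|%:R < s]%SET|%:R.
Proof.
move=> r0 s0; pose good : {set T} := [set v | s <= #|cball r v|%:R]%SET.
pose packing (C : {set T}) := (C \subset good) && [forall x in C, forall y in C,
  (x != y) ==> [disjoint cball r x & cball r y]].
have pack0 : packing finset.set0.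
  apply/andP; split; first exact: finset.sub0set.
  by apply/forall_inP => x; rewrite inE.
have [C /maxsetP[/andP[Cgood /forall_inP Cdisj] Cmax] _] := maxset_exists pack0.
have near_center v : v \in good -> exists2 c, c \in C & dist e w c v <= 2 * r.
  move=> gv; have [vC|vC] := boolP (v \in C).
    by exists v; rewrite // dist_self mulr_ge0.
  have [/existsP[c /andP[cC /pred0Pn[x /andP[/= xc xv]]]]|] :=
    boolP [exists c, (c \in C) && ~~ [disjoint cball r c & cball r v]].
    exists c => //; apply: le_trans (dist_triangle _ x _) _.
    by move: xc xv; rewrite !inE (dist_sym x); lra.
  rewrite negb_exists => /forallP Cv.
  have Cv' c : c \in C -> [disjoint cball r c & cball r v]%bool.
    by move=> cC; have := Cv c; rewrite cC negbK.
  suff vCE : (v |: C)%SET = C by move: vC; rewrite -vCE finset.setU11.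
  apply: Cmax (finset.subsetUr _ _); apply/andP; split.
    by apply/fintype.subsetP => x /setU1P[->//|/(fintype.subsetP Cgood)].
  apply/forall_inP => x /setU1P[->|xC]; apply/forall_inP => y /setU1P[->|yC];
    apply/implyP => xy.
  - by rewrite eqxx in xy.
  - by rewrite disjoint_sym Cv'.
  - exact: Cv'.
  - by have /forall_inP/(_ _ yC)/implyP := Cdisj _ xC; apply.
(* The default makes a vertex far from all of [C] its own centre; by [near_center] this happens only
   when its ball is small. *)
pose center v := odflt v [pick c in C | dist e w c v <= 2 * r].
have dist_center v : dist e w (center v) v <= 2 * r.
  rewrite /center; case: pickP => [c /andP[]//|_] /=.
  by rewrite dist_self mulr_ge0.
pose Q := preim_partition center [set: T]%SET.
have QC : clustering e w (4 * r) Q.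
  apply/andP; split; first exact: preim_partitionP.
  apply/forall_inP => _ /imsetP[z _ ->]; rewrite /diam.
  apply/bigmax_leP; split=> [|x]; first by rewrite mulr_ge0.
  rewrite !inE => /eqP zx; apply/bigmax_leP; split=> [|y]; first by rewrite mulr_ge0.
  rewrite !inE => /eqP zy; apply: le_trans (dist_triangle _ (center z) _) _.
  have := dist_center x; have := dist_center y.
  by rewrite -zx -zy (dist_sym x); lra.
have cardQ : (#|Q| <= #|C| + #|[set v | (#|cball r v|%:R < s)%R]%SET|)%N.
  pose block c : {set T} := [set y | c == center y]%SET.
  apply: leq_trans (_ : #|C :|: [set v | (#|cball r v|%:R < s)%R]|%SET <= _)%N; last first.
    exact: leq_card_setU.
  apply: leq_trans (leq_imset_card block _); apply/subset_leq_card/fintype.subsetP.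
  move=> _ /imsetP[z _ ->]; apply/imsetP; exists (center z); last first.
    by apply/setP => y; rewrite !inE.
  rewrite inE /center; case: pickP => [c /andP[->]//|none] /=.
  apply/orP; right; rewrite inE ltNge; apply/negP => gz.
  have [|c cC cz] := near_center z; first by rewrite inE.
  by have := none c; rewrite cC cz.
have cardC : #|C|%:R <= #|T|%:R / s.
  rewrite ler_pdivlMr//.
  apply: (@le_trans _ _ (\sum_(c in C) #|cball r c|%:R)).
    rewrite mulrC mulr_natr -sumr_const; apply: ler_sum => c cC.
    by have := fintype.subsetP Cgood _ cC; rewrite inE.
  rewrite -natr_sum ler_nat; under eq_bigr do rewrite -sum1_card big_mkcond.
  rewrite exchange_big -sum1_card; apply: leq_sum => x _; rewrite -big_mkcondr.
  have [/existsP[c /andP[cC xc]]|] := boolP [exists c, (c \in C) && (x \in cball r c)].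
    rewrite (bigD1 c) ?cC//= big1 ?addn0// => c' /andP[/andP[c'C xc'] c'c].
    have /forall_inP/(_ _ cC)/implyP/(_ c'c)/disjointFr/(_ xc') := Cdisj _ c'C.
    by rewrite xc.
  rewrite negb_exists => /forallP none; rewrite big1// => c cxc.
  by have := none c; rewrite cxc.
apply: (@le_trans _ _ #|Q|%:R).
  rewrite ler_nat /nclusters; case: arg_minnP => [|Q' _ ->//].
  by apply: clustering_singletons; rewrite mulr_ge0.
apply: le_trans (_ : (#|C| + #|[set v | (#|cball r v|%:R < s)]%SET|)%:R <= _).
  by rewrite ler_nat.
by rewrite natrD lerD2r.
Qed.

End Distance.

(** * The cut parameter and the drift of one step *)

Lemma alpha_ge0 (R : realType) (T : finType) (e : rel T) : 0 <= alpha R e.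
Proof.
have ratio0 (U : {set T}) : 0 <= cut_ratio R e U by exact: divr_ge0.
have [T1|T1] := ltnP 1 #|T|.
  by have [U _ [-> _]] := alpha_attained R e T1.
suff -> : alpha R e = inf set0 by rewrite inf0.
congr inf; apply/seteqP; split => // x [U /andP[U0 UT] _]; move: (proper_card UT).
by rewrite cardsT ltnNge (leq_trans T1)// card_gt0.
Qed.

Lemma alpha_le_cut (R : realType) (T : finType) (e : rel T) (U : {set T}) :
  alpha R e * (#|U|%:R * (#|T|%:R - #|U|%:R)) <= #|cut e U|%:R.
Proof.
rewrite -natrB ?max_card// -natrM.
have [->|U0] := eqVneq U finset.set0; first by rewrite cards0 mul0n mulr0.
have [->|UT] := eqVneq U [set: T]%SET; first by rewrite cardsT subnn muln0 mulr0.
have pU : U \proper [set: T]%SET by rewrite finset.properEneq UT finset.subsetT.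
have U_gt0 : (0 < #|U| * (#|T| - #|U|))%N.
  by rewrite muln_gt0 card_gt0 U0 subn_gt0 -[ltnRHS]cardsT proper_card.
rewrite -ler_pdivlMr ?ltr0n//; apply: ge_inf.
  by exists 0 => _ [V _ <-]; rewrite divr_ge0.
by exists U => //; apply/andP.
Qed.

(** Put j = |U| and y = eps |cut U| <= 1/8. Then 1 - exp(-y) >= y/(1+y) >= (8/9) y, and y >= alpha
    eps j (9/10) n since j <= n/10. Dividing by j + 1 <= 2j leaves (8/9)(9/10)(1/2) = 2/5, and 1 - c
    <= exp(-c) concludes. *)
Lemma exploration_drift (R : realType) (T : finType) (e : rel T) (eps : R)
    (U : {set T}) :
  0 <= eps -> eps * #|edges e|%:R <= 8^-1 -> U != finset.set0 ->
  (10 * #|U| <= #|T|)%N ->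
  expR (- eps) ^+ #|cut e U| / #|U|%:R +
    (1 - expR (- eps) ^+ #|cut e U|) / #|U|.+1%:R <=
  expR (- (2 / 5 * (alpha R e * #|T|%:R * eps))) / #|U|%:R.
Proof.
move=> eps0 small U0 UT; rewrite -expRM_natl mulrN [_%:R * eps]mulrC.
have al0 := alpha_ge0 R e; have al := alpha_le_cut R e U.
have m_le : #|cut e U|%:R <= #|edges e|%:R :> R.
  by rewrite ler_nat subset_leq_card// cut_sub_edges.
have j1 : 1 <= #|U|%:R :> R by rewrite ler1n card_gt0.
have jn : 10 * #|U|%:R <= #|T|%:R :> R by rewrite -natrM ler_nat.
rewrite -natr1.
move: (alpha R e) #|cut e U|%:R #|U|%:R #|T|%:R #|edges e|%:R al0 al m_le j1 jn small
  => al m j n E al0 alm mE j1 jn small.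
have j0 : 0 < j by exact: lt_le_trans j1.
have n0 : 0 <= n by lra.
have m0 : 0 <= m by apply: le_trans alm; rewrite !mulr_ge0//; lra.
set y := eps * m; have y0 : 0 <= y by exact: mulr_ge0.
have y8 : y <= 8^-1 by apply: le_trans small; exact: ler_wpM2l.
set q := expR (- y).
have q_le : 1 - q >= 8 / 9 * y.
  have : q * (1 + y) <= 1.
    rewrite /q expRN mulrC ler_pdivrMr ?expR_gt0// mul1r; exact: expR_ge1Dx.
  have : 0 < q by exact: expR_gt0.
  nra.
have rho_ge := expR_ge1Dx (- (2 / 5 * (al * n * eps))).
rewrite (_ : q / j + (1 - q) / (j + 1) = (1 - (1 - q) / (j + 1)) / j); last first.
  by field; rewrite !gt_eqF ?addr_gt0.
rewrite ler_pM2r ?invr_gt0//; apply: le_trans rho_ge; rewrite lerD2l lerN2.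
rewrite ler_pdivlMr ?addr_gt0//; apply: le_trans q_le.
have e1 : al * eps * (j * (n - j)) <= y.
  by rewrite /y [al * _]mulrC -mulrA; exact: ler_wpM2l.
have e2 : al * eps * (j * (9 / 10 * n)) <= al * eps * (j * (n - j)).
  by apply: ler_wpM2l; [exact: mulr_ge0|apply: ler_wpM2l; lra].
have e3 : al * eps * n * (j + 1) <= al * eps * n * (2 * j).
  by apply: ler_wpM2l; [rewrite !mulr_ge0|lra].
lra.
Qed.

(** * Passing to the expectation *)

Section Expectation.
Context (R : realType) (T : finType) (e : rel T).
Context (d : measure_display) (Omega : measurableType d).
Context (P : probability Omega R).
Context (W : {set T} -> {RV P >-> R}).
Context (e_sym : symmetric e) (e_irr : irreflexive e).
Context (e_conn : forall x y : T, connect e x y).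
Context (W_exp : forall f, f \in edges e -> has_exp1_law (W f)).
Context (W_ind : mutually_independent (edges e) W).

Let wt (omega : Omega) : {set T} -> R := fun f => W f omega.
Let pos : set Omega :=
  \bigcap_(f in [set f | f \in edges e]) (W f @^-1` `]0, +oo[).

Lemma prW_pos f : f \in edges e -> prW W f `]0, +oo[ = 1.
Proof. by move=> fe; rewrite (prW_tail W_exp)// oppr0 expR0. Qed.

Lemma ae_weight_gt0 : \forall omega \ae P, pos omega.
Proof.
have mpos : measurable pos.
  apply: fin_bigcap_measurable => [|f _]; first exact: finite_finset.
  exact: measurable_weight_mem.
exists (~` pos); split => //; first exact: measurableC.
rewrite probability_setC// W_ind//.
under eq_bigr => f fe do rewrite prWE// prW_pos//.
by rewrite prodEFin big1// subee.
Qed.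

Definition slow_ball (s eps : R) (L : nat) (v : T) : set Omega :=
  slow e eps W s L [set v]%SET (fun=> 0) (fun=> `]0, +oo[%classic).

(** The distance from [v] satisfies the constraints of [reach_dual], so the explored set lies in the
    ball. Its triangle inequality uses nonnegative weights, which hold only almost surely; hence
    [pos]. *)
Lemma slow_ballP s eps L v omega : 0 <= eps -> pos omega ->
  #|cball e (wt omega) (L%:R * eps) v|%:R < s -> slow_ball s eps L v omega.
Proof.
move=> eps0 w_pos small; split => //=; apply: le_lt_trans small.
have w_ge0 x y : e x y -> 0 <= wt omega [set x; y]%SET.
  by move=> xy; have := w_pos _ (edge_mem xy); rewrite /preimage/= in_itv/= andbT => /ltW.
rewrite ler_nat; apply/subset_leq_card/fintype.subsetP => x xr.
rewrite inE -[leRHS]add0r.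
apply: (reach_dual e_sym e_irr eps0 (a := fun=> 0) (U := [set v]%SET)
  (D := dist e (wt omega) v)) xr => //.
- by move=> y; rewrite inE => /eqP ->; rewrite dist_self.
- by move=> y z yz; rewrite inE => /eqP <- _; rewrite add0r subr0; exact: dist_edge.
- move=> y z yz; apply: le_trans (dist_triangle e_conn w_ge0 v y z) _.
  by rewrite lerD2l; exact: dist_edge.
Qed.

(** Integrate [nclusters_le], whose count of small balls is almost surely at most the sum of the
    indicators of the slow balls. *)
Lemma expectation_nclusters (s eps : R) (L : nat) : 0 < s -> 0 <= eps ->
  ('E_P[fun omega => (nclusters e (wt omega) (4 * (L%:R * eps)))%:R] <=
   (#|T|%:R / s)%:E + \sum_v P (slow_ball s eps L v))%E.
Proof.
move=> s0 eps0.
have mS v : measurable (slow_ball s eps L v) by exact: measurable_slow.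
have mI v : measurable_fun setT (fun omega => (\1_(slow_ball s eps L v) omega : R)%:E).
  by apply/measurable_EFinP; exact: measurable_indic.
have -> : ((#|T|%:R / s)%:E + \sum_v P (slow_ball s eps L v) =
  \int[P]_omega ((#|T|%:R / s)%:E + \sum_v (\1_(slow_ball s eps L v) omega)%:E))%E.
  rewrite ge0_integralD//; last 3 first.
  - by move=> omega _; rewrite lee_fin divr_ge0// ltW.
  - by move=> omega _; apply: sume_ge0.
  - exact: emeasurable_sum.
  rewrite integral_cst// [X in (_ * X)%E]probability_setT mule1 ge0_integral_sum//.
  congr (_ + _)%E; apply: eq_bigr => v _.
  by rewrite integral_indic// setIT.
rewrite unlock; apply: ae_ge0_le_integral => //.
- apply/measurable_EFinP; exact: measurable_nclusters.
- by move=> omega _; rewrite adde_ge0 ?sume_ge0// lee_fin divr_ge0// ltW.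
- by apply: emeasurable_funD => //; exact: emeasurable_sum.
apply: filterS ae_weight_gt0 => omega w_pos _.
rewrite sumEFin -EFinD lee_fin.
have w_ge0 x y : e x y -> 0 <= wt omega [set x; y]%SET.
  by move=> xy; have := w_pos _ (edge_mem xy); rewrite /preimage/= in_itv/= andbT => /ltW.
apply: le_trans (nclusters_le e_sym e_conn w_ge0 _ s0) _; first by rewrite mulr_ge0.
rewrite lerD2l -sum1_card natr_sum big_mkcond/=; apply: ler_sum => v _.
rewrite inE; case: ifP => // small; rewrite indicE mem_set//.
exact: slow_ballP.
Qed.

Lemma prob_slow_ball (s eps : R) (L : nat) (v : T) :
  0 <= s -> 0 <= eps -> eps * #|edges e|%:R <= 8^-1 ->
  s <= #|T|.+1%:R / 10 ->
  (P (slow_ball s eps L v) <=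
   (expR (- (2 / 5 * (alpha R e * #|T|%:R * (L%:R * eps)))) * s)%:E)%E.
Proof.
move=> s0 eps0 small sT.
apply: le_trans (prob_slow e_sym e_irr eps0 W_exp W_ind
  (rho := expR (- (2 / 5 * (alpha R e * #|T|%:R * eps)))) s0 _ _ _ _ _ _) _.
- exact: expR_ge0.
- move=> U U0 Us; apply: exploration_drift => //.
  (* The numerator n + 1 in the bound on [s] suffices: 10|U| < n + 1 is 10|U| <= n for integers. *)
  move: (lt_le_trans Us sT).
  by rewrite ltr_pdivlMr// mulrC -natrM ltr_nat ltnS.
- by apply/finset.set0Pn; exists v; rewrite inE.
- by [].
- by [].
rewrite lee_fin cards1 divr1 big1 ?mulr1; last by move=> f; exact: prW_pos.
by rewrite -expRM_natl (_ : _ * - _ = - (2 / 5 * (alpha R e * #|T|%:R * (L%:R * eps)))) //; ring.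
Qed.

End Expectation.

Unset Implicit Arguments.

Theorem theorem1 (R : realType) :
  exists K : R, forall (T : finType) (e : rel T)
    (d : measure_display) (Omega : measurableType d) (P : probability Omega R)
    (W : {set T} -> {RV P >-> R}) (Delta : R),
    symmetric e -> irreflexive e -> (forall x y : T, connect e x y) ->
    (forall f : {set T}, f \in edges e -> has_exp1_law (W f)) ->
    mutually_independent (edges e) W ->
    0 <= Delta ->
    ('E_P[fun omega => (nclusters e (fun f => W f omega) (4 * Delta))%:R] <=
     (K * (1 + #|T|%:R / expR (alpha R e * Delta * #|T|%:R / 5)))%:E)%E.
Proof.
exists 10 => T e d Omega P W Delta e_sym e_irr e_conn W_exp W_ind Delta0.
set x := alpha R e * Delta * #|T|%:R.
pose s : R := Num.min (expR (x / 5)) (#|T|.+1%:R / 10).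
have s0 : 0 < s by rewrite lt_min expR_gt0 divr_gt0.
have s_le : s <= #|T|.+1%:R / 10 by rewrite ge_min lexx orbT.
(* Cut [Delta] into steps so fine that even all edges together have rate at most 1/8 per step; the
   successor [L.+1] avoids division by 0. *)
have [L [eps [eps0 small DeltaE]]] : exists (L : nat) (eps : R),
    [/\ 0 <= eps, eps * #|edges e|%:R <= 8^-1 & Delta = L%:R * eps].
  have [L hL] : exists L : nat, 8 * Delta * #|edges e|%:R <= L%:R.
    by exists (Num.truncn (8 * Delta * #|edges e|%:R)).+1; exact/ltW/truncnS_gt.
  exists L.+1, (Delta / L.+1%:R); split.
  - by rewrite divr_ge0.
  - rewrite mulrAC ler_pdivrMr ?ltr0n// -[L.+1%:R]natr1; lra.
  - by rewrite mulrC divfK// pnatr_eq0.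
rewrite DeltaE.
apply: le_trans (expectation_nclusters e_sym e_irr e_conn W_exp W_ind L s0 eps0) _.
apply: (@le_trans _ _ ((#|T|%:R / s)%:E + \sum_(v : T) (expR (- (x / 5)))%:E)%E).
  apply: leeD => //; apply: lee_sum => v _.
  apply: le_trans (prob_slow_ball e_sym e_irr W_exp W_ind L v (ltW s0) eps0 small s_le) _.
  rewrite lee_fin -DeltaE.
  apply: le_trans (_ : expR (- (2 / 5 * (alpha R e * #|T|%:R * Delta))) * expR (x / 5) <= _).
    by rewrite ler_wpM2l ?expR_ge0// ge_min lexx.
  by rewrite -expRD ler_expR /x; lra.
rewrite sumEFin -EFinD lee_fin sumr_const -mulr_natl expRN.
(* If the minimum [s] is (n+1)/10, then n/s <= 10. The total is thus at most 10 + 2n/exp(x/5),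
   within the constant 10. *)
have : #|T|%:R / s <= #|T|%:R / expR (x / 5) + 10.
  have [ex|ex] := leP (expR (x / 5)) (#|T|.+1%:R / 10).
    by rewrite /s min_l// lerDl.
  rewrite /s min_r; last exact: ltW.
  apply: (@le_trans _ _ 10); last by rewrite lerDr divr_ge0 ?expR_ge0.
  rewrite invf_div mulrA ler_pdivrMr// mulrC ler_wpM2l// ler_nat//.
have : 0 <= #|T|%:R / expR (x / 5) by rewrite divr_ge0 ?expR_ge0.
lra.
Qed.
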